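(* Fix $\varepsilon>0$. For a positive integer $t$ and a prime power $q$, let $N_t(q)$ denote the number of elements $a\in\mathbb{F}_q$ such that the binomial $X^t-a\in\mathbb{F}_q[X]$ is irreducible over $\mathbb{F}_q$. Then, uniformly over real $Q$ and positive integers $t$ with $\mathrm{rad}_4(t)\le Q^{1-\varepsilon}$, we have $$\sum_{q\le Q} N_t(q)\le (1+o(1))\frac{Q^2}{\mathrm{rad}_4(t)\,\log\big(Q/\mathrm{rad}_4(t)\big)}$$ as $Q\to\infty$, where the sum is over prime powers $q\le Q$. (That is, for every $\delta>0$ there is $Q_0$, depending only on $\varepsilon$ and $\delta$, such that for all $Q\ge Q_0$ and all positive integers $t$ with $\mathrm{rad}_4(t)\le Q^{1-\varepsilon}$ the sum is at most $(1+\delta)Q^2/(\mathrm{rad}_4(t)\log(Q/\mathrm{rad}_4(t)))$.)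
   Context: $\mathrm{rad}(t)$ denotes the largest squarefree divisor of $t$ (the product of the distinct primes dividing $t$). Define $\mathrm{rad}_4(t)=\mathrm{rad}(t)$ if $4\nmid t$ and $\mathrm{rad}_4(t)=2\,\mathrm{rad}(t)$ if $4\mid t$. The letter $q$ always denotes a prime power. Convention: $\log x=\max\{\ln x,2\}$, where $\ln$ is the natural logarithm. *)

(* Defs.v *)
From HB Require Import structures.
From mathcomp Require Import all_boot all_order all_algebra all_field.
From mathcomp Require Import all_classical all_reals all_analysis.

Set Implicit Arguments.
Unset Strict Implicit.
Unset Printing Implicit Defensive.

Import Order.TTheory GRing.Theory Num.Theory.
Local Open Scope ring_scope.

Definition rad (t : nat) : nat := (\prod_(p <- primes t) p)%N.

Definition rad4 (t : nat) : nat := if (4 %| t)%N then (2 * rad t)%N else rad t.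

Definition prime_power (q : nat) : Prop :=
  exists p k : nat, [/\ prime p, (0 < k)%N & q = (p ^ k)%N].

Definition log {R : realType} (x : R) : R := Num.max (ln x) 2.

Definition irred_binomials (F : finFieldType) (t : nat) : nat :=
  #|[pred a : F | `[< irreducible_poly ('X^t - a%:P) >]]|.

(* A choice of a field with q elements for every prime power q; the value at
   any other q is arbitrary. *)
Definition finite_fields (F : nat -> finFieldType) : Prop :=
  forall q, prime_power q -> #|F q| = q.

Lemma finite_fields_exist : exists F, finite_fields F.
Proof.
have ex q : exists K : finFieldType, prime_power q -> #|K| = q.
  have [[p [k [p_pr k_gt0 ->]]]|nq] := pselect (prime_power q).
    by have [K _ cardK] := pPrimePowerField p_pr k_gt0; exists K.
  by exists 'F_2.
by exists (fun q => projT1 (cid (ex q))) => q; exact: projT2 (cid (ex q)).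
Qed.

(* Main.v *)
Require Import Defs.
From HB Require Import structures.
From mathcomp Require Import all_boot all_order all_algebra all_fingroup.
From mathcomp Require Import all_solvable all_field.
From mathcomp Require Import all_classical all_reals all_analysis.
From mathcomp Require Import ring lra zify.

Set Implicit Arguments.
Unset Strict Implicit.
Unset Printing Implicit Defensive.

Import Order.TTheory GRing.Theory Num.Theory.
Local Open Scope ring_scope.

(** If [X^t - a] is irreducible over [F_q], then [m = rad4 t] divides [q - 1] and
    [a] is not a [p]-th power for any prime [p] dividing [t]; as the unit group
    is cyclic, this leaves at most [q phi(m) / m] values of [a].  It remains to
    bound the sum of the prime powers [q <= Q] with [q = 1] modulo [m].  Those
    divisible by a prime [p <= z] number at most [z log Q / log 2].  All others
    survive the sieving of the weights [n * 1_{n = 1 mod m}] by the primes up to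
    [z], and Selberg's sieve bounds their sum by [Q^2 / (2 m G) + 3 Q z^2], where
    [G], the sum of [1 / phi d] over squarefree [d <= z] prime to [m], is at
    least [phi(m) / m] times the harmonic sum up to [z].  With
    [z^2 = (Q / m)^(1 - eta)] the main term is
    [Q^2 / ((1 - eta) phi(m) log (Q / m))]: the weight [n] halves the constant 2
    of the Brun-Titchmarsh inequality. *)

(** * Irreducible binomials over finite fields *)

Lemma irreducible_poly_factor_size (F : fieldType) (f g : {poly F}) :
  irreducible_poly (f * g) -> (size f != 1)%N -> size f = size (f * g).
Proof.
by move=> [_ irr] f1; apply/eqp_size/irr => //; apply: dvdp_mulr.
Qed.

(** [X^(s p) - b^p] is divisible by [X^s - b], whose degree is positive and smaller. *)
Lemma reducible_binomial_expn (F : fieldType) (t p : nat) (b : F) :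
  (0 < t)%N -> (1 < p)%N -> (p %| t)%N ->
  ~ irreducible_poly ('X^t - (b ^+ p)%:P).
Proof.
move=> t_gt0 p_gt1 /dvdnP[s e]; subst t.
have s_gt0 : (0 < s)%N by move: t_gt0; rewrite muln_gt0 => /andP[].
rewrite exprM rmorphXn /= subrXX => irr.
have := irreducible_poly_factor_size irr; rewrite size_XnsubC // eqSS -lt0n s_gt0.
move=> /(_ isT); rewrite -subrXX -exprM -rmorphXn size_XnsubC ?muln_gt0 ?s_gt0
  //=; last lia.
by move=> []; nia.
Qed.

(** Sophie Germain's identity [X^4 + 4 c^4 = (X^2 + 2 c X + 2 c^2) (X^2 - 2 c X + 2 c^2)], taken at
    [X^s]. *)
Lemma reducible_binomial_quartic (F : fieldType) (t : nat) (c : F) :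
  (0 < t)%N -> (4 %| t)%N ->
  ~ irreducible_poly ('X^t - (- (4 * c ^+ 4))%:P).
Proof.
move=> t_gt0 /dvdnP[s e]; subst t.
have s_gt0 : (0 < s)%N by move: t_gt0; rewrite muln_gt0 => /andP[].
have size_factor (c' : F) :
    size ('X^(s * 2) + ((2 * c') *: 'X^s + (2 * c' ^+ 2)%:P)) = (s * 2).+1.
  rewrite size_polyDl ?size_polyXn // ltnS.
  apply: leq_trans (size_polyD _ _) _; rewrite geq_max.
  apply/andP; split; last by apply: leq_trans (size_polyC_leq1 _) _; lia.
  by apply: leq_trans (size_scale_leq _ _) _; rewrite size_polyXn; lia.
have -> : 'X^(s * 4) - (- (4 * c ^+ 4))%:P =
  ('X^(s * 2) + ((2 * c) *: 'X^s + (2 * c ^+ 2)%:P))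
  * ('X^(s * 2) + ((2 * - c) *: 'X^s + (2 * (- c) ^+ 2)%:P)) :> {poly F}.
  by rewrite -!mul_polyC !exprM !(rmorphM, rmorphXn, rmorphN, rmorph_nat) /=; ring.
move=> irr; have := irreducible_poly_factor_size irr; rewrite size_factor eqSS.
have -> : (s * 2 != 0)%N by lia.
move=> /(_ isT); rewrite size_mul -?size_poly_gt0 ?size_factor //; lia.
Qed.

Lemma expf_card_pred (F : finFieldType) (a : F) : a != 0 -> a ^+ #|F|.-1 = 1.
Proof.
move=> a0; apply: (mulfI a0).
by rewrite -exprS prednK ?expf_card ?mulr1 // ltnW // finNzRing_gt1.
Qed.

(** By Bezout [u p = v (#|F| - 1) + 1] for some [u] and [v], so that a nonzero [a] is the [p]-th
    power of [a ^ u]. *)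
Lemma finField_expn_surj (F : finFieldType) (p : nat) (a : F) :
  prime p -> ~~ (p %| #|F|.-1)%N -> exists b, a = b ^+ p.
Proof.
move=> p_pr ndv; have [->|a0] := eqVneq a 0.
  by exists 0; rewrite expr0n eqn0Ngt prime_gt0.
have : coprime p #|F|.-1 by rewrite prime_coprime.
case/(coprimeP _ (prime_gt0 p_pr)) => -[u v] /= uv; exists (a ^+ u).
have -> : (a ^+ u) ^+ p = a ^+ (v * #|F|.-1).+1.
  by rewrite -exprM -addn1 -uv subnKC // ltnW // -subn_gt0 uv.
by rewrite exprS mulnC exprM expf_card_pred // expr1n mulr1.
Qed.

(** The exponent is taken below the order of the unit group, so that counting elements reduces to
    counting exponents. *)
Lemma finField_generator (F : finFieldType) :
  exists g : F, forall a, a != 0 -> exists2 k, (k < #|F|.-1)%N & a = g ^+ k.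
Proof.
have /cyclicP[x genx] := field_unit_group_cyclic [set: {unit F}]%G.
exists (val x) => a a0.
have ua : a \is a GRing.unit by rewrite unitfE.
have : FinRing.Unit ua \in <[x]>%g by rewrite -genx inE.
case/cycleP => k ek; exists (k %% #|F|.-1)%N.
  by rewrite ltn_mod -subn1 subn_gt0 finNzRing_gt1.
have ox : #[x]%g = #|F|.-1 by rewrite orderE -genx card_finField_unit.
by have := congr1 val ek; rewrite -expg_mod_order ox /= FinRing.val_unitX.
Qed.

Lemma coprime_bigprod (I : Type) (s : seq I) (f : I -> nat) (P : pred I) (a : nat) :
  (forall i, P i -> coprime a (f i)) -> coprime a (\prod_(i <- s | P i) f i).
Proof.
move=> co; elim/big_ind: _ => //; first exact: coprimen1.
by move=> x y cox coy; rewrite coprimeMr cox.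
Qed.

Lemma coprime_prime_notin (p : nat) (s : seq nat) :
  prime p -> all prime s -> p \notin s -> coprime p (\prod_(q <- s) q)%N.
Proof.
move=> p_pr pr_s ps; rewrite big_seq; apply: coprime_bigprod => q qs.
have q_pr : prime q := allP pr_s q qs.
rewrite prime_coprime // dvdn_prime2 //.
by apply: contra ps => /eqP ->.
Qed.

Lemma dvdn_prod_primes (s : seq nat) (n : nat) :
  uniq s -> all prime s -> (forall p, p \in s -> p %| n)%N ->
  (\prod_(p <- s) p %| n)%N.
Proof.
elim: s => [|p s IHs] /=; first by rewrite big_nil dvd1n.
move=> /andP[ps us] /andP[p_pr pr_s] H; rewrite big_cons Gauss_dvd.
  by rewrite H ?mem_head // IHs // => q qs; rewrite H // inE qs orbT.
exact: coprime_prime_notin.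
Qed.

Lemma totient_prod_primes (s : seq nat) :
  uniq s -> all prime s ->
  totient (\prod_(p <- s) p)%N = (\prod_(p <- s) p.-1)%N.
Proof.
elim: s => [|p s IHs] /=; first by rewrite !big_nil.
move=> /andP[ps us] /andP[p_pr pr_s]; rewrite !big_cons totient_coprime.
  by rewrite totient_prime // IHs.
exact: coprime_prime_notin.
Qed.

Lemma all_prime_primes (t : nat) : all prime (primes t).
Proof. by apply/allP => p; rewrite mem_primes => /andP[]. Qed.

(** Coprimality to [r] has period [r], and the range consists of [s] full periods. *)
Lemma count_coprime_multiple (r s : nat) :
  (\sum_(0 <= k < s * r) coprime r k = s * totient r)%N.
Proof.
elim: s => [|s IHs]; first by rewrite big_geq.
rewrite (big_cat_nat _ (n := s * r)) //=; last by rewrite leq_mul2r leqnSn orbT.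
rewrite IHs !mulSnr; apply/eqP; rewrite eqn_add2l; apply/eqP.
rewrite -{1}[(s * r)%N]add0n big_addn addKn.
rewrite totient_count_coprime; apply: eq_bigr => k _.
by rewrite addnC -coprime_modr modnMDl coprime_modr.
Qed.

(** * Conditions on the field, and the count of admissible constants *)

Section IrreducibleBinomials.
Variables (F : finFieldType) (t : nat).
Hypothesis t_gt0 : (0 < t)%N.

(** Otherwise every element of [F] is a [p]-th power, and the binomial factors. *)
Lemma irreducible_binomial_dvd_card (p : nat) (a : F) :
  irreducible_poly ('X^t - a%:P) -> prime p -> (p %| t)%N -> (p %| #|F|.-1)%N.
Proof.
move=> irr p_pr pt; apply/idPn => /(finField_expn_surj a p_pr)[b eb].
by rewrite eb in irr; apply: reducible_binomial_expn irr => //; apply: prime_gt1.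
Qed.

(** This accounts for the factor 2 in [rad4]. If [#|F| - 1 = 2 h] with [h] odd, the nonsquare [a]
    satisfies [a ^ h = -1]; this forces [a = - 4 c ^ 4] for some [c], against the quartic
    factorization. *)
Lemma irreducible_binomial_dvd4_card (a : F) :
  irreducible_poly ('X^t - a%:P) -> (4 %| t)%N -> (4 %| #|F|.-1)%N.
Proof.
move=> irr t4; have t2 : (2 %| t)%N by apply: dvdn_trans t4.
have /dvdnP[h eh] := irreducible_binomial_dvd_card irr (isT : prime 2) t2.
apply/idPn => n4; have odd_h : odd h.
  by move: n4; rewrite eh -[4%N]/(2 * 2)%N dvdn_pmul2r // dvdn2 negbK.
have not_sqr b : a <> b ^+ 2.
  by move=> eb; rewrite eb in irr; apply: reducible_binomial_expn irr.
have a0 : a != 0 by apply/eqP => e; apply: (not_sqr 0); rewrite e expr0n.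
have fermat (x : F) : x != 0 -> x ^+ (h * 2) = 1.
  by move=> x0; rewrite -eh expf_card_pred.
(* If [a ^ h = 1] with [h] odd, then [a = a ^ (h + 1)] is a square. *)
have ah1 : a ^+ h != 1.
  apply/eqP => e; apply: (not_sqr (a ^+ h.+1./2)).
  by rewrite -exprM muln2 even_halfK ?exprS ?e ?mulr1 //= negbK.
have ahN1 : a ^+ h = -1.
  have /eqP : (a ^+ h) ^+ 2 = 1 by rewrite -exprM fermat.
  by rewrite sqrf_eq1 (negPf ah1) => /eqP.
(* If 2 vanished, [-1] would equal 1, a value already excluded for [a ^ h]. *)
have two0 : (2 : F) != 0.
  apply: contra ah1 => /eqP e; rewrite ahN1 eq_sym -subr_eq0 opprK.
  exact/eqP.
(* [w ^ h = 1] with [h] odd, so [w] is a fourth power and [a = - 4 w]. *)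
pose w : F := - a / 4.
have four0 : (4 : F) != 0 by rewrite -[4%N]/(2 * 2)%N natrM mulf_neq0.
have wh : w ^+ h = 1.
  rewrite /w exprMn exprNn -signr_odd odd_h ahN1 mulrN1 opprK mul1r exprVn.
  by rewrite -[4%N]/(2 ^ 2)%N natrX -exprM mulnC fermat // invr1.
(* As [h ^ 2 = 1] modulo 4, [3 h ^ 2 + 1] is a multiple [4 k]; since [w ^ h = 1],
   [w = w ^ (3 h ^ 2 + 1)] is the fourth power of [w ^ k]. *)
have /dvdnP[k ek] : (4 %| 3 * (h * h) + 1)%N.
  rewrite -[h]odd_double_half odd_h; apply/dvdnP.
  by exists (3 * h./2 ^ 2 + 3 * h./2 + 1)%N; rewrite -muln2; lia.
apply: (@reducible_binomial_quartic F t (w ^+ k) t_gt0 t4).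
rewrite -exprM -ek exprD expr1 [(3 * _)%N]mulnC -mulnA exprM wh expr1n mul1r.
by rewrite /w mulrC divfK // opprK.
Qed.

Lemma irred_binomials_dvd_card :
  (0 < irred_binomials F t)%N -> (rad4 t %| #|F|.-1)%N.
Proof.
rewrite /irred_binomials => /card_gt0P[a]; rewrite unfold_in /= => /asboolP irr.
have dvd_rad : (Defs.rad t %| #|F|.-1)%N.
  apply: dvdn_prod_primes; rewrite ?primes_uniq ?all_prime_primes // => p.
  by rewrite mem_primes => /and3P[p_pr _ pt];
    apply: irreducible_binomial_dvd_card irr _ _.
rewrite /rad4; case: ifP => // t4.
have d4 := irreducible_binomial_dvd4_card irr t4.
(* Extracting the prime 2 from the radical writes [rad4 t] as 4 times a product of odd primes, and
   the two coprime factors are treated separately. *)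
have m2 : (2%N \in primes t) by rewrite mem_primes t_gt0 /= (dvdn_trans _ t4).
move: dvd_rad; rewrite /Defs.rad (perm_big _ (perm_to_rem m2)) /= big_cons
  mulnA => dvd_rad.
rewrite Gauss_dvd ?d4 /=; first by apply: dvdn_trans dvd_rad; apply: dvdn_mull.
rewrite (coprimeXl 2 (m := 2)) //; apply: coprime_prime_notin => //.
  by apply/allP => q /mem_rem; apply/allP/all_prime_primes.
by rewrite mem_rem_uniqF ?primes_uniq.
Qed.

(** Write [a = g ^ k] with [k < #|F| - 1 = s * rad t]. A prime dividing both [k] and [t] would make
    [a] a [p]-th power, so at most [s * phi(rad t)] exponents remain. *)
Lemma irred_binomials_le :
  (Defs.rad t %| #|F|.-1)%N ->
  (irred_binomials F t * Defs.rad t <= #|F| * totient (Defs.rad t))%N.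
Proof.
case/dvdnP => s es.
(* For [t = 1] the value [a = 0] counts as well; for [t > 1] a prime divisor [p] of [t] excludes it,
   since 0 is a [p]-th power. *)
have [t1|t_gt1] := leqP t 1.
  have -> : t = 1%N by lia.
  by rewrite /Defs.rad big_nil totientE // big_nil !muln1 max_card.
have [g gen] := finField_generator F.
suff le : (irred_binomials F t <= s * totient (Defs.rad t))%N.
  apply: leq_trans (leq_mul le (leqnn _)) _; rewrite mulnAC leq_mul2r.
  by rewrite -es leq_pred orbT.
pose K : {set 'I_(s * Defs.rad t)} := [set k : 'I_(s * Defs.rad t) | coprime
  (Defs.rad t) k].
have cK : #|K| = (s * totient (Defs.rad t))%N.
  rewrite -count_coprime_multiple big_mkord -sum1_card big_mkcond /=.
  by apply: eq_bigr => k _; rewrite inE; case: coprime.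
pose f (k : 'I_(s * Defs.rad t)) : F := g ^+ k.
rewrite -cK; apply: leq_trans _ (leq_imset_card f K).
apply/subset_leq_card/fintype.subsetP => a; rewrite unfold_in /= => /asboolP irr.
have not_pow p b : p \in primes t -> a <> b ^+ p.
  rewrite mem_primes => /and3P[p_pr _ pt] e; rewrite e in irr.
  by apply: reducible_binomial_expn irr => //; apply: prime_gt1.
have a0 : a != 0.
  apply/eqP => e; apply: (not_pow (pdiv t) 0).
    by rewrite mem_primes pdiv_prime // t_gt0 pdiv_dvd.
  by rewrite e expr0n eqn0Ngt pdiv_gt0.
have [k lt_k ek] := gen a a0; rewrite es in lt_k.
apply/imsetP; exists (Ordinal lt_k) => //; rewrite inE /= coprime_sym.
rewrite /Defs.rad big_seq; apply: coprime_bigprod => p pt.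
have p_pr : prime p by move: pt; rewrite mem_primes => /andP[].
rewrite coprime_sym prime_coprime //; apply/negP => /dvdnP[j ej].
by apply: (not_pow p (g ^+ j) pt); rewrite -exprM -ej.
Qed.

End IrreducibleBinomials.

(** * Arithmetic progressions *)

(** Passing from [N] to [N + 1], the quotient increases exactly when [M] divides [N + M - r]. *)
Lemma count_progression (M r N : nat) : (r < M)%N ->
  (\sum_(0 <= n < N | (n == r %[mod M])%N) 1 = (N + (M - r.+1)) %/ M)%N.
Proof.
move=> ltrM; have M_gt0 : (0 < M)%N by apply: leq_ltn_trans ltrM.
elim: N => [|N IHN]; first by rewrite big_geq // add0n divn_small // -subSn //
  subSS leq_subr.
rewrite big_mkcond big_nat_recr //= -big_mkcond IHN /= addSn divnS //.
rewrite addnC; congr (_ + _)%N; rewrite -addnS -subSn // subSS.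
have -> : (M %| N + (M - r))%N = (N == r %[mod M])%N.
  by rewrite -(eqn_modDr (M - r) N r) subnKC ?(ltnW ltrM) // modnn.
by case: eqP.
Qed.

Lemma count_progression_bound (R : realFieldType) (M r N : nat) : (0 < M)%N ->
  `|(\sum_(0 <= n < N | (n == r %[mod M])%N) 1)%N%:R - N%:R / M%:R| <= 1 :> R.
Proof.
move=> M_gt0.
have -> : (\sum_(0 <= n < N | (n == r %[mod M])%N) 1
          = (N + (M - (r %% M).+1)) %/ M)%N.
  by rewrite -count_progression ?ltn_mod //; under eq_bigl do rewrite -(modn_mod r).
set a := (M - _)%N; have lt_aM : (a < M)%N by rewrite /a ltn_subrL M_gt0.
set k := (_ %/ M)%N.
have M0 : 0 < M%:R :> R by rewrite ltr0n.
have -> : k%:R - N%:R / M%:R = (k%:R * M%:R - N%:R) / M%:R :> R.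
  by field; rewrite gt_eqF.
rewrite normrM [X in _ * X]gtr0_norm ?invr_gt0 // ler_pdivrMr // mul1r.
have e : (N + a = k * M + (N + a) %% M)%N by rewrite {1}(divn_eq (N + a) M).
have lt_r : ((N + a) %% M < M)%N by rewrite ltn_mod.
move: e lt_r; set s := (_ %% M)%N => /(congr1 (fun n => n%:R : R)).
rewrite !natrD natrM => e lt_sM.
have a1 : a%:R < M%:R :> R by rewrite ltr_nat.
have s1 : s%:R < M%:R :> R by rewrite ltr_nat.
have := ler0n R a; have := ler0n R s => s0 a0.
rewrite ler_norml; apply/andP; split; lra.
Qed.

(** Summation by parts, which reduces the weight [n] to plain counts. *)
Lemma sum_progressionE (R : realFieldType) (P : pred nat) (N : nat) :
  \sum_(0 <= n < N.+1 | P n) n%:R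
  = N%:R * (\sum_(0 <= n < N.+1 | P n) 1)%N%:R
    - \sum_(0 <= k < N.+1) (\sum_(0 <= n < k | P n) 1)%N%:R :> R.
Proof.
elim: N => [|N IHN].
  by rewrite !big_nat1 [LHS]big_mkcond big_nat1 mul0r big_geq // subr0 if_same.
rewrite [LHS]big_mkcond big_nat_recr //= -big_mkcond IHN.
rewrite [X in _ = _ - X]big_nat_recr //=.
rewrite [X in _ = _ * X%:R - _]big_mkcond [X in _ = _ * X%:R - _]big_nat_recr //=.
rewrite -big_mkcond natrD -[N.+1%:R]natr1.
by case: (P N.+1); rewrite /=; ring.
Qed.

(** The count below [k] is [k / M] up to 1. After summation by parts, [N] times the last count, the
    sum of the earlier counts and the leftover [N / (2 M)] each contribute an error of at most
    [N]. *)
Lemma sum_progression_bound (R : realFieldType) (M r N : nat) : (0 < M)%N ->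
  `|\sum_(0 <= n < N.+1 | (n == r %[mod M])%N) n%:R - N%:R ^+ 2 / (2 * M%:R)|
    <= 3 * N%:R :> R.
Proof.
move=> M_gt0; rewrite sum_progressionE.
have M0 : 0 < M%:R :> R by rewrite ltr0n.
have W : `|\sum_(0 <= k < N.+1) (\sum_(0 <= n < k | (n == r %[mod M])%N) 1)%N%:R
          - (N%:R * N.+1%:R) / (2 * M%:R)| <= N%:R :> R.
  elim: N => [|N IHN].
    by rewrite big_nat1 big_geq // mul0r mul0r subr0 normr0.
  rewrite big_nat_recr //=.
  have := count_progression_bound R r N.+1 M_gt0.
  have -> : N.+1%:R * N.+2%:R / (2 * M%:R)
     = N%:R * N.+1%:R / (2 * M%:R) + N.+1%:R / M%:R :> R.
    by rewrite -[N.+2%:R]natr1 -[N.+1%:R]natr1; field; rewrite gt_eqF.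
  move: IHN; rewrite !ler_norml -[X in _ -> _ -> _ <= _ <= X]natr1.
  by rewrite -[X in _ -> _ -> - X <= _ <= _]natr1 => /andP[? ?] /andP[? ?]; lra.
have C := count_progression_bound R r N.+1 M_gt0.
have N0 := ler0n R N.
have {}C : `|N%:R * (\sum_(0 <= n < N.+1 | (n == r %[mod M])%N) 1)%N%:R
             - N%:R * (N.+1%:R / M%:R)| <= N%:R :> R.
  by rewrite -mulrBr normrM ger0_norm // ler_piMr.
have e : N%:R * (N.+1%:R / M%:R) = N%:R * N.+1%:R / (2 * M%:R) 
     + N%:R ^+ 2 / (2 * M%:R) + N%:R / (2 * M%:R) :> R.
  by rewrite -[N.+1%:R]natr1; field; rewrite gt_eqF.
have M1 : 1 <= M%:R :> R by rewrite (ler_nat _ 1).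
have e1 : 0 <= N%:R / (2 * M%:R) :> R by rewrite divr_ge0 // mulr_ge0 // ltW.
have e2 : N%:R / (2 * M%:R) <= N%:R :> R.
  by rewrite ler_pdivrMr ?ler_peMr //; lra.
move: W C e1 e2; rewrite e !ler_norml => /andP[? ?] /andP[? ?] ? ?; lra.
Qed.

(** * Selberg's sieve *)

Section SelbergWeights.
Variables (R : realFieldType) (T : finType) (p : T -> nat) (z : nat).
Hypotheses (p_gt1 : forall i, (1 < p i)%N) (z_gt0 : (0 < z)%N).

(** A squarefree number is encoded by the set of its prime indices: when the [p i] are distinct
    primes, lcm becomes union, gcd intersection, and the Moebius function [(-1) ^ #|A|]. *)
Definition set_prod (A : {set T}) : nat := (\prod_(i in A) p i)%N.

Definition inv_phi (A : {set T}) : R := \prod_(i in A) ((p i)%:R - 1)^-1.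

Definition selberg_G : R := \sum_(A : {set T} | (set_prod A <= z)%N) inv_phi A.

(** This is [G] times the absolute value of Selberg's [lambda_d]; the sum runs over the squarefree
    multiples of [d] up to [z]. *)
Definition selberg_tail (A : {set T}) : R :=
  (set_prod A)%:R *
  \sum_(B : {set T} | (set_prod B <= z)%N && (A \subset B)) inv_phi B.

(* [selberg_weight A] is Selberg's [lambda_d] for [d = set_prod A]. *)
Definition selberg_weight (A : {set T}) : R :=
  (-1) ^+ #|A| * selberg_tail A / selberg_G.

Lemma set_prod_gt0 A : (0 < set_prod A)%N.
Proof. by rewrite prodn_gt0 // => i; apply: ltnW. Qed.

Lemma set_prod_neq0 A : (set_prod A)%:R != 0 :> R.
Proof. by rewrite pnatr_eq0 -lt0n set_prod_gt0. Qed.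

Lemma set_prodE A : (set_prod A)%:R = \prod_(i in A) (p i)%:R :> R.
Proof. by rewrite natr_prod. Qed.

Lemma set_prodU1 i (A : {set T}) : i \notin A -> set_prod (i |: A) = (p i *
  set_prod A)%N.
Proof. by move=> iA; rewrite /set_prod big_setU1. Qed.

Lemma inv_phiU1 i (A : {set T}) :
  i \notin A -> inv_phi (i |: A) = ((p i)%:R - 1)^-1 * inv_phi A.
Proof. by move=> iA; rewrite /inv_phi big_setU1. Qed.

Lemma prime_sub1_gt0 i : 0 < (p i)%:R - 1 :> R.
Proof. by rewrite subr_gt0 (ltr_nat R 1). Qed.

Lemma inv_phi_gt0 A : 0 < inv_phi A.
Proof. by apply: prodr_gt0 => i _; rewrite invr_gt0 prime_sub1_gt0. Qed.

Lemma selberg_G_gt0 : 0 < selberg_G.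
Proof.
rewrite /selberg_G (bigD1 finset.set0) /=; last by rewrite /set_prod big_set0.
by rewrite ltr_wpDr ?inv_phi_gt0 // sumr_ge0 // => A _; apply/ltW/inv_phi_gt0.
Qed.

Lemma selberg_tail_ge0 A : 0 <= selberg_tail A.
Proof. by rewrite mulr_ge0 // sumr_ge0 // => B _; apply/ltW/inv_phi_gt0. Qed.

Lemma selberg_tail0 : selberg_tail finset.set0 = selberg_G.
Proof.
rewrite /selberg_tail /set_prod big_set0 mul1r.
by apply: eq_bigl => A; rewrite finset.sub0set andbT.
Qed.

Lemma selberg_weight0 : selberg_weight finset.set0 = 1.
Proof.
by rewrite /selberg_weight cards0 selberg_tail0 mul1r divff ?gt_eqF ?selberg_G_gt0.
Qed.

(* Compare the sets [B] containing [A] but not [i] with the sets [i |: B], whose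
   product is larger. *)
Lemma selberg_tailU1 i (A : {set T}) :
  i \notin A -> selberg_tail (i |: A) <= selberg_tail A.
Proof.
move=> iA; rewrite /selberg_tail set_prodU1 // natrM mulrAC [leLHS]mulrC.
apply: ler_wpM2l => //.
rewrite [leRHS](bigID (fun B : {set T} => i \in B)) /=.
set S1 := \sum_(_ | _) _.
have -> : \sum_(B : {set T} | (set_prod B <= z)%N && (A \subset B) && (i \in B))
            inv_phi B = S1.
  apply: eq_bigl => B.
  by rewrite finset.subUset finset.sub1set -andbA [(A \subset B) && _]andbC.
rewrite -[X in X * S1](subrK 1) mulrDl mul1r [leLHS]addrC lerD2l.
rewrite mulr_sumr.
rewrite (reindex_onto (fun B => i |: B) (fun B => B :\ i)) /=; last first.
  by move=> B /andP[_]; rewrite finset.subUset finset.sub1set => /andP[iB _];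
    rewrite finset.setD1K.
rewrite big_mkcond [leRHS]big_mkcond; apply: ler_sum => B _.
case: ifP => [/andP[/andP[le_z subAB] /eqP eqB] | _]; last first.
  by case: ifP => // _; apply/ltW/inv_phi_gt0.
have iB : i \notin B by rewrite -eqB !inE eqxx.
have -> : (set_prod B <= z)%N && (A \subset B) && (i \notin B).
  rewrite iB andbT; apply/andP; split.
    apply: leq_trans le_z; rewrite set_prodU1 // leq_pmull //; exact: ltnW.
  by rewrite -eqB finset.subsetD1 iA (fintype.subset_trans _ subAB) ?finset.subsetUr.
by rewrite inv_phiU1 // mulVKf ?gt_eqF ?prime_sub1_gt0.
Qed.

(** Delete the elements of [A] one at a time; at the empty set the tail is [G]. *)
Lemma selberg_tail_le A : selberg_tail A <= selberg_G.
Proof.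
elim: {A}_.+1 {-2}A (ltnSn #|A|) => // n IHn A leAn.
have [->|[i iA]] := set_0Vmem A; first by rewrite selberg_tail0.
rewrite -(finset.setD1K iA); apply: le_trans (selberg_tailU1 _) (IHn _ _).
  by rewrite !inE eqxx.
by move: leAn; rewrite (cardsD1 i) iA.
Qed.

(** With this bound the remainder of the sieve is controlled by the number of pairs of divisors up
    to [z]. *)
Lemma selberg_weight_norm A : `|selberg_weight A| <= 1.
Proof.
rewrite /selberg_weight normrM normrM normrX normrN1 expr1n mul1r.
rewrite ger0_norm ?selberg_tail_ge0 // gtr0_norm ?invr_gt0 ?selberg_G_gt0 //.
by rewrite ler_pdivrMr ?selberg_G_gt0 // mul1r selberg_tail_le.
Qed.

Lemma selberg_weight_supp A : (z < set_prod A)%N -> selberg_weight A = 0.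
Proof.
move=> ltzA; rewrite /selberg_weight /selberg_tail big1 ?mulr0 ?mul0r //.
move=> B /andP[le_z sAB]; move: ltzA; rewrite ltnNge => /negP[].
apply: leq_trans le_z; rewrite /set_prod [X in (_ <= X)%N](big_setID A) /=.
by rewrite (finset.setIidPr sAB) leq_pmulr // prodn_gt0 // => i; apply: ltnW.
Qed.

(** Moebius inversion on the subset lattice. The sum expands a product with one factor per [i],
    which is [-1] for [i] in both sets, 1 for [i] in neither, and 0 otherwise. *)
Lemma sum_sign_between (E F : {set T}) :
  \sum_(A : {set T} | (E \subset A) && (A \subset F)) (-1) ^+ #|A|
  = (-1) ^+ #|E| * (E == F)%:R :> R.
Proof.
pose f i : R := - (i \in F)%:R; pose g i : R := (i \notin E)%:R.
have -> : \sum_(A : {set T} | (E \subset A) && (A \subset F)) (-1) ^+ #|A|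
  = \sum_(A : {set T}) \prod_i (if i \in A then f i else g i).
  rewrite big_mkcond; apply: eq_bigr => A _.
  rewrite (bigID (fun i => i \in A)) /=.
  rewrite (eq_bigr f); last by move=> i ->.
  rewrite [X in _ * X](eq_bigr g); last by move=> i /negPf->.
  case: (boolP (A \subset F)) => [sAF|]; last first.
    by case/subsetPn => i iA iF; rewrite andbF (bigD1 i) //= /f (negPf iF)
      oppr0 !mul0r.
  case: (boolP (E \subset A)) => [sEA|]; last first.
    by case/subsetPn => i iE iA; rewrite (bigD1 (P := fun i => i \notin A) i)
      //= /g iE !mul0r mulr0.
  rewrite [X in _ * X]big1 ?mulr1; last first.
    by move=> i iA; rewrite /g (contra (fintype.subsetP sEA i)).
  rewrite (eq_bigr (fun=> -1)) ?prodr_const // => i iA.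
  by rewrite /f (fintype.subsetP sAF).
have <- : \prod_i (f i + g i) = \sum_(A : {set T}) \prod_i (if i \in A then f i
  else g i).
  by rewrite bigA_distr.
have [eqEF|neqEF] := eqVneq E F.
  rewrite mulr1 -prodr_const [RHS]big_mkcond /=; apply: eq_bigr => i _.
  by rewrite /f /g -eqEF; case: (i \in E); rewrite /= ?addr0 ?oppr0 ?add0r.
rewrite mulr0; case: (boolP (E \subset F)) => [sEF|/subsetPn[i iE iF]]; last first.
  by rewrite (bigD1 i) //= /f /g iE (negPf iF) oppr0 addr0 mul0r.
have /subsetPn[i iF iE] : ~~ (F \subset E) by apply: contra neqEF => sFE;
  rewrite finset.eqEsubset sEF.
by rewrite (bigD1 i) //= /f /g iF iE addNr mul0r.
Qed.

(** The identity [sum_(e | d) phi e = d], obtained by expanding the product of the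
    [(p i - 1) + 1]. *)
Lemma sum_phi_subset (C : {set T}) :
  \sum_(E : {set T} | E \subset C) \prod_(i in E) ((p i)%:R - 1)
  = \prod_(i in C) (p i)%:R :> R.
Proof.
pose f i : R := if i \in C then (p i)%:R - 1 else 0.
transitivity (\prod_i (f i + 1)).
  rewrite bigA_distr big_mkcond; apply: eq_bigr => A _.
  rewrite -big_mkcond /=; case: ifPn => [sAC|/subsetPn[i iA iC]].
    by apply: eq_bigr => i iA; rewrite /f (fintype.subsetP sAC).
  by rewrite (bigD1 i) //= /f (negPf iC) mul0r.
rewrite [RHS]big_mkcond; apply: eq_bigr => i _; rewrite /f.
by case: ifP; rewrite ?subrK ?add0r.
Qed.

Lemma inv_phiV (E : {set T}) : \prod_(i in E) ((p i)%:R - 1) = (inv_phi E)^-1.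
Proof. by rewrite /inv_phi prodfV invrK. Qed.

(** These sums are the coordinates that diagonalise the quadratic form. After the summations are
    exchanged, the signed sum over the [A] between [E] and [B] leaves only [B = E]. *)
Lemma selberg_weight_dual (E : {set T}) :
  \sum_(A : {set T} | E \subset A) selberg_weight A / (set_prod A)%:R
  = (-1) ^+ #|E| / selberg_G * (if (set_prod E <= z)%N then inv_phi E else 0).
Proof.
transitivity (selberg_G^-1 * \sum_(A : {set T} | E \subset A)
   \sum_(B : {set T} | (set_prod B <= z)%N && (A \subset B))
     (-1) ^+ #|A| * inv_phi B).
  rewrite mulr_sumr; apply: eq_bigr => A _.
  rewrite /selberg_weight /selberg_tail -mulr_sumr.
  set S := \sum_(_ | _) _; move: (set_prod_neq0 A) => dA.
  by field; rewrite dA gt_eqF ?selberg_G_gt0.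
rewrite (exchange_big_dep (fun B : {set T} => set_prod B <= z)%N) /=; last first.
  by move=> A B _ /andP[].
transitivity (selberg_G^-1 * \sum_(B : {set T} | (set_prod B <= z)%N)
   inv_phi B * ((-1) ^+ #|E| * (E == B)%:R)).
  congr (_ * _); apply: eq_bigr => B leB.
  rewrite -sum_sign_between mulr_sumr.
  apply: eq_big => [A|A _]; first by rewrite leB.
  exact: mulrC.
rewrite -[RHS]mulrA [RHS]mulrCA; congr (_ * _).
rewrite big_mkcond (bigD1 E) //= eqxx mulr1 big1 => [|B /negPf neqB].
  by rewrite addr0; case: ifP; rewrite ?mulr0 // mulrC.
by rewrite eq_sym neqB !mulr0 if_same.
Qed.

(* Diagonalisation: [d_A d_B / d_(A :|: B)] is the sum over [E \subset A :&: B] of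
   [phi (d_E)]. *)
Lemma selberg_quadratic_form :
  \sum_(A : {set T}) \sum_(B : {set T})
     selberg_weight A * selberg_weight B / (set_prod (A :|: B))%:R
  = selberg_G^-1.
Proof.
pose y (A : {set T}) := selberg_weight A / (set_prod A)%:R.
transitivity (\sum_(A : {set T}) \sum_(B : {set T})
   \sum_(E : {set T} | E \subset A :&: B) (inv_phi E)^-1 * (y A * y B)).
  apply: eq_bigr => A _; apply: eq_bigr => B _.
  rewrite -mulr_suml (eq_bigr _ (fun E _ => esym (inv_phiV E))) sum_phi_subset.
  rewrite -set_prodE /y.
  have : (set_prod (A :|: B))%:R * (set_prod (A :&: B))%:R
          = (set_prod A)%:R * (set_prod B)%:R :> R.
    rewrite -!natrM; congr _%:R; rewrite /set_prod.
    rewrite (big_setID (A := A :|: B) A) (big_setID (A := B) A) /=.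
    rewrite finset.setIUl finset.setIid (finset.setUidPl (finset.subsetIr _ _)).
    by rewrite finset.setDUl finset.setDv finset.set0U [B :&: A]finset.setIC
      -mulnA [X in (_ * X)%N]mulnC.
  move: (set_prod_neq0 A) (set_prod_neq0 B) (set_prod_neq0 (A :|: B))
    (set_prod_neq0 (A :&: B)).
  move: (set_prod A)%:R (set_prod B)%:R (set_prod (A :|: B))%:R (set_prod (A
    :&: B))%:R.
  move=> a b u v a0 b0 u0 v0 uv.
  have -> : v = a * b / u by rewrite -uv mulrC mulKf.
  by field; rewrite a0 b0 u0.
rewrite pair_big /= (exchange_big_dep predT) //=.
transitivity (\sum_(E : {set T}) (inv_phi E)^-1 *
   (\sum_(A : {set T} | E \subset A) y A) ^+ 2).
  apply: eq_bigr => E _; rewrite -mulr_sumr expr2 big_distrlr /= pair_big /=.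
  congr (_ * _).
  by apply: eq_bigl => -[A B] /=; rewrite finset.subsetI.
under eq_bigr do rewrite selberg_weight_dual.
(* Squaring removes the sign and one factor [inv_phi E] survives, so that the total is
   [G / G ^ 2]. *)
transitivity (\sum_(E : {set T} | (set_prod E <= z)%N) selberg_G ^-2 * inv_phi E).
  rewrite [RHS]big_mkcond; apply: eq_bigr => E _.
  case: ifP => _; last by rewrite !mulr0 expr0n mulr0.
  rewrite !exprMn -exprM mulnC exprM sqrrN expr1n expr1n mul1r exprVn.
  have := inv_phi_gt0 E; have := selberg_G_gt0 => G0 E0.
  by field; rewrite !gt_eqF.
rewrite -mulr_sumr -/selberg_G; have := selberg_G_gt0 => G0.
by field; rewrite !gt_eqF.
Qed.

End SelbergWeights.

(** * The sieve inequality on a progression, with weight [n] *)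

Section SelbergSieve.
Variables (R : realFieldType) (T : finType) (p : T -> nat) (z : nat).
Hypotheses (p_prime : forall i, prime (p i)) (p_inj : injective p).
Hypothesis z_gt0 : (0 < z)%N.

Local Notation d := (set_prod p).
Local Notation G := (selberg_G R p z).
Local Notation lam := (selberg_weight R p z).
Let p_gt1 i : (1 < p i)%N := prime_gt1 (p_prime i).

Lemma set_prod_dvdP (n : nat) (A : {set T}) :
  reflect (forall i, i \in A -> (p i %| n)%N) (d A %| n)%N.
Proof.
apply: (iffP idP) => [dA i iA|].
  by apply: dvdn_trans dA; rewrite /set_prod (bigD1 i) //= dvdn_mulr.
elim: {A}_.+1 {-2}A (ltnSn #|A|) => // k IHk A leAk H.
have [->|[i iA]] := set_0Vmem A; first by rewrite /set_prod big_set0 dvd1n.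
rewrite -(finset.setD1K iA) set_prodU1 ?inE ?eqxx // Gauss_dvd.
  rewrite H // IHk //; first by move: leAk; rewrite (cardsD1 i) iA.
  by move=> j; rewrite !inE => /andP[_]; apply: H.
apply: coprime_bigprod => j; rewrite !inE => /andP[neq_ji _].
rewrite prime_coprime // dvdn_prime2 //; apply: contra neq_ji => /eqP /p_inj ->.
exact: eqxx.
Qed.

Lemma set_prod_dvdU (n : nat) (A B : {set T}) :
  (d (A :|: B) %| n)%N = (d A %| n)%N && (d B %| n)%N.
Proof.
apply/set_prod_dvdP/andP => [H|[/set_prod_dvdP HA /set_prod_dvdP HB] i].
  by split; apply/set_prod_dvdP => i iA; apply: H; rewrite inE iA ?orbT.
by rewrite inE => /orP[]; [apply: HA|apply: HB].
Qed.

(** If [i] were outside [A], the larger number [p i * d A] would divide [d A]. *)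
Lemma mem_set_prod (i : T) (A : {set T}) : (p i %| d A)%N = (i \in A).
Proof.
apply/idP/idP => [dv|iA]; last exact: (set_prod_dvdP _ _ (dvdnn _)).
apply: contraLR (dvdnn (d A)) => iA; apply/negP => _.
have : (d (i |: A) %| d A)%N.
  by rewrite set_prod_dvdU /set_prod big_set1 dv dvdnn.
rewrite set_prodU1 // => /dvdn_leq; rewrite set_prod_gt0 // => /(_ isT).
by rewrite leqNgt ltn_Pmull ?set_prod_gt0.
Qed.

Lemma set_prod_inj : injective d.
Proof. by move=> A B eqd; apply/setP => i; rewrite -!mem_set_prod eqd. Qed.

(** Distinct sets have distinct products, and the products counted lie between 1 and [z]. *)
Lemma card_set_prod_le : (#|[pred A : {set T} | (d A <= z)%N]| <= z)%N.
Proof.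
case: z z_gt0 => // k _; rewrite -[X in (_ <= X)%N]card_ord.
apply: (@leq_card_in _ _ (fun A => inord (d A).-1 : 'I_k.+1)) => A B.
rewrite !inE => leA leB /(congr1 val) /=.
have A0 := set_prod_gt0 p_gt1 A; have B0 := set_prod_gt0 p_gt1 B.
rewrite !inordK -?[(_ < k.+1)%N]ltnS ?prednK // => eqAB; apply: set_prod_inj.
by rewrite -(prednK A0) eqAB prednK.
Qed.

Lemma sum_norm_selberg_weight : \sum_(A : {set T}) `|lam A| <= z%:R.
Proof.
apply: (@le_trans _ _ (\sum_(A : {set T} | (d A <= z)%N) 1)).
  rewrite [leRHS]big_mkcond; apply: ler_sum => A _; case: leqP => [_|ltzA].
    exact: selberg_weight_norm.
  by rewrite selberg_weight_supp ?normr0.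
by rewrite sumr_const ler_nat card_set_prod_le.
Qed.

(** The square of the sum of [lam A] over [d A] dividing [n] is nonnegative, and it is 1 at every
    sieved [n]. Opening it gives sums over progressions: the main terms form the quadratic form with
    value [1 / G], and the errors are at most [3 N] times the square of the sum of the [|lam A|]. *)
Theorem selberg_sieve (m N : nat) :
  (0 < m)%N -> (forall i, coprime m (p i)) ->
  \sum_(0 <= n < N.+1 | (n == 1 %[mod m])%N && [forall i, ~~ (p i %| n)%N]) n%:R
  <= N%:R ^+ 2 / (2 * m%:R) / G + 3 * N%:R * z%:R ^+ 2.
Proof.
move=> m_gt0 co_m.
pose L n : R := \sum_(A : {set T} | (d A %| n)%N) lam A.
apply: (@le_trans _ _ (\sum_(0 <= n < N.+1 | (n == 1 %[mod m])%N) n%:R * L n ^+ 2)).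
  rewrite big_mkcond [leRHS]big_mkcond; apply: ler_sum => n _.
  case: (n == 1 %[mod m])%N => //=; case: ifP => [/forallP nodv|_]; last first.
    by rewrite mulr_ge0 // sqr_ge0.
  (* A sieved [n] is divisible by [d A] only for the empty set, whose weight is 1. *)
  suff -> : L n = 1 by rewrite expr1n mulr1.
  rewrite /L (big_pred1 finset.set0) ?selberg_weight0 // => A.
  apply/set_prod_dvdP/eqP => [H|-> i]; last by rewrite inE.
  by apply/setP => i; rewrite inE; apply/negP => /H; apply/negP.
pose W (A B : {set T}) : R :=
  \sum_(0 <= n < N.+1 | (n == 1 %[mod m])%N && (d (A :|: B) %| n)%N) n%:R.
have -> : \sum_(0 <= n < N.+1 | (n == 1 %[mod m])%N) n%:R * L n ^+ 2
  = \sum_(A : {set T}) \sum_(B : {set T}) lam A * lam B * W A B.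
  transitivity (\sum_(0 <= n < N.+1 | (n == 1 %[mod m])%N) \sum_(A : {set T})
    \sum_(B : {set T})
      (if (d (A :|: B) %| n)%N then lam A * lam B * n%:R else 0)).
    apply: eq_bigr => n _; rewrite expr2 big_distrlr /= mulr_sumr big_mkcond /=.
    apply: eq_bigr => A _; case: ifP => dA; last first.
      by rewrite big1 // => B _; rewrite set_prod_dvdU dA.
    rewrite mulr_sumr big_mkcond; apply: eq_bigr => B _.
    by rewrite set_prod_dvdU dA /=; case: ifP => // _; rewrite mulrC.
  rewrite exchange_big; apply: eq_bigr => A _ /=.
  rewrite exchange_big; apply: eq_bigr => B _ /=.
  by rewrite /W mulr_sumr -big_mkcondr.
(* By the Chinese remainder theorem the two congruences form one class modulo [m * d (A :|: B)]. *)
have HW A B : `|W A B - N%:R ^+ 2 / (2 * m%:R) / (d (A :|: B))%:R| <= 3 * N%:R.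
  have co : coprime m (d (A :|: B)) by apply: coprime_bigprod.
  have d0 : (0 < d (A :|: B))%N by apply: set_prod_gt0.
  have := @sum_progression_bound R (m * d (A :|: B)) (chinese m (d (A :|: B)) 1 0) N.
  rewrite muln_gt0 m_gt0 d0 => /(_ isT); rewrite natrM.
  set u := W A B; set v := (X in `|X - _|); have -> : v = u.
    rewrite /u /v /W; apply: eq_bigl => n.
    by rewrite chinese_remainder // chinese_modl // chinese_modr // [X in _ &&
      X]eqn_mod_dvd ?subn0.
  by rewrite mulrA [(2 * _ * _)^-1]invfM [X in `|u - X| <= _ -> _]mulrA.
apply: (@le_trans _ _ (\sum_(A : {set T}) \sum_(B : {set T})
   (N%:R ^+ 2 / (2 * m%:R) * (lam A * lam B / (d (A :|: B))%:R)
     + 3 * N%:R * (`|lam A| * `|lam B|)))).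
  apply: ler_sum => A _; apply: ler_sum => B _.
  have -> : lam A * lam B * W A B =
    N%:R ^+ 2 / (2 * m%:R) * (lam A * lam B / (d (A :|: B))%:R) +
    lam A * lam B * (W A B - N%:R ^+ 2 / (2 * m%:R) / (d (A :|: B))%:R) by ring.
  rewrite lerD2l; apply: le_trans (ler_norm _) _.
  by rewrite !normrM [leRHS]mulrC ler_wpM2l ?mulr_ge0 ?HW.
under eq_bigr do rewrite big_split /= -!mulr_sumr.
rewrite big_split /= -!mulr_sumr selberg_quadratic_form // lerD2l.
rewrite ler_wpM2l ?mulr_ge0 //.
have -> : \sum_(A : {set T}) (`|lam A| * \sum_(B : {set T}) `|lam B|)
        = (\sum_(A : {set T}) `|lam A|) ^+ 2 by rewrite expr2 mulr_suml.
rewrite ler_sqr ?nnegrE ?sumr_ge0 //.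
exact: sum_norm_selberg_weight.
Qed.

End SelbergSieve.

(** * The lower bound for [G] *)

Section SmoothSums.
Variable R : realFieldType.

Definition smooth_sum (ps : seq nat) (x : nat) : R :=
  \sum_(1 <= n < x.+1 | all (mem ps) (primes n)) n%:R^-1.

(* The sum of [1 / phi d] over the squarefree [d <= x] with all prime factors in
   [ps], computed by splitting off the prime [p]. *)
Fixpoint sqfree_sum (ps : seq nat) (x : nat) : R :=
  if ps is p :: ps' then
    sqfree_sum ps' x + (p%:R - 1)^-1 * sqfree_sum ps' (x %/ p)
  else (0 < x)%:R.

Definition euler_factor (ps : seq nat) : R := \prod_(p <- ps) (p%:R / (p%:R - 1)).

Lemma euler_factor_ge0 ps : 0 <= euler_factor ps.
Proof.
apply: prodr_ge0 => -[|n] _; first by rewrite mul0r.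
by rewrite divr_ge0 // subr_ge0 ler1n.
Qed.

Lemma smooth_sumS ps x : smooth_sum ps x.+1 =
  smooth_sum ps x + (if all (mem ps) (primes x.+1) then x.+1%:R^-1 else 0).
Proof. by rewrite /smooth_sum [LHS]big_mkcond big_nat_recr //= [in
  RHS]big_mkcond. Qed.

Lemma smooth_sum_mono ps x y : (x <= y)%N -> smooth_sum ps x <= smooth_sum ps y.
Proof.
move=> /subnK <-; elim: (y - x)%N => // k IHk; rewrite addSn smooth_sumS.
by apply: le_trans IHk _; rewrite lerDl; case: ifP => // _; rewrite invr_ge0.
Qed.

(** The [n] divisible by [p] are the [p n'] with [n' <= x / p], where [n'] may again be divisible by
    [p]; hence [p :: ps] on the right. *)
Lemma smooth_sum_cons p ps x : prime p -> p \notin ps ->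
  smooth_sum (p :: ps) x = smooth_sum ps x + p%:R^-1 * smooth_sum (p :: ps) (x %/ p).
Proof.
move=> p_pr pps; elim: x => [|x IHx].
  by rewrite div0n /smooth_sum !big_geq // mulr0 addr0.
rewrite !smooth_sumS IHx divnS ?prime_gt0 //.
have [dv|ndv] := boolP (p %| x.+1)%N; last first.
  rewrite add0n addrAC; congr (_ + _ + _); congr (if _ then _ else _).
  apply: eq_in_all => q; rewrite mem_primes => /and3P[_ _ qx] /=.
  by rewrite inE; case: eqP qx ndv => // -> ->.
have -> : all (mem ps) (primes x.+1) = false.
  apply/negbTE/allPn; exists p; rewrite ?pps //.
  by rewrite mem_primes p_pr dv.
rewrite addr0 add1n smooth_sumS mulrDr addrA; congr (_ + _).
have e := divnS x (prime_gt0 p_pr); rewrite dv add1n in e.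
have {1 2}-> : x.+1 = (p * (x %/ p).+1)%N by rewrite mulnC -e divnK.
have -> : all (mem (p :: ps)) (primes (p * (x %/ p).+1))
        = all (mem (p :: ps)) (primes (x %/ p).+1).
  apply/allP/allP => H q qx; last first.
    move: qx; rewrite primesM ?(prime_gt0 p_pr) // => /orP[|/H //].
    by rewrite primes_prime // mem_seq1 => /eqP ->; exact: mem_head.
  by apply: H; rewrite primesM ?(prime_gt0 p_pr) // qx orbT.
by case: ifP; rewrite ?mulr0 // natrM invfM.
Qed.

(** Replace [x / p] by [x] in the recursion and solve for the sum: the factor is that of the full
    geometric series in [1 / p]. *)
Lemma smooth_sum_cons_le p ps x : prime p -> p \notin ps ->
  smooth_sum (p :: ps) x <= p%:R / (p%:R - 1) * smooth_sum ps x.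
Proof.
move=> p_pr pps; have e := smooth_sum_cons x p_pr pps.
have le := smooth_sum_mono (p :: ps) (leq_div x p).
have p1 : 1 < p%:R :> R by rewrite ltr1n prime_gt1.
rewrite mulrAC ler_pdivlMr; last lra.
have {}e : p%:R * smooth_sum (p :: ps) x = p%:R * smooth_sum ps x + smooth_sum
  (p :: ps) (x %/ p).
  by rewrite e mulrDr mulVKf // gt_eqF //; lra.
lra.
Qed.

(** [1 / phi d] is the sum of [1 / n] over all [n] with the same prime factors as [d], and [n <= x]
    implies [d <= x]. In the induction the multiples of [p] bring the factor [1 / p] times
    [p / (p - 1)], that is [1 / (p - 1)]. *)
Lemma smooth_sum_le_sqfree ps x : uniq ps -> all prime ps ->
  smooth_sum ps x <= sqfree_sum ps x.
Proof.
elim: ps x => [|p ps IHps] x /=.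
  move=> _ _; case: x => [|x]; first by rewrite /smooth_sum big_geq.
  rewrite /smooth_sum big_mkcond big_nat_recl //= invr1 big1_seq ?addr0 // => n.
  rewrite mem_index_iota => /andP[_ /andP[n_gt0 _]].
  case E : (primes n.+1) => [|q s] //=.
  have : pdiv n.+1 \in primes n.+1 by rewrite mem_primes pdiv_prime // pdiv_dvd.
  by rewrite E.
move=> /andP[pps ups] /andP[p_pr pr_ps].
have p1 : 1 < p%:R :> R by rewrite ltr1n prime_gt1.
rewrite smooth_sum_cons // lerD ?IHps //.
apply: le_trans (_ : (p%:R - 1)^-1 * smooth_sum ps (x %/ p) <= _); last first.
  by rewrite ler_wpM2l ?IHps // invr_ge0; lra.
rewrite -(ler_pM2l (_ : 0 < p%:R)); last lra.
by rewrite mulVKf ?gt_eqF ?mulrA ?smooth_sum_cons_le //; lra.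
Qed.

Lemma smooth_sum_cat ms ps x : uniq (ms ++ ps) -> all prime ms ->
  smooth_sum (ms ++ ps) x <= euler_factor ms * smooth_sum ps x.
Proof.
elim: ms => [|p ms IHms] /=; first by rewrite /euler_factor big_nil mul1r.
move=> /andP[pn u] /andP[p_pr pr]; have p1 : 1 < p%:R :> R by rewrite ltr1n prime_gt1.
rewrite /euler_factor big_cons -mulrA.
apply: le_trans (smooth_sum_cons_le x p_pr pn) _.
by rewrite mulrA -[leRHS]mulrA ler_wpM2l ?IHms // divr_ge0 // subr_ge0 ltW.
Qed.

(** Splitting the sets by whether they contain the head [i] matches the recursion, as
    [p i * d B <= x] means [d B <= x %/ p i]. *)
Lemma sqfree_sum_sets (T : finType) (p : T -> nat) (s : seq T) (x : nat) :
  (forall i, (1 < p i)%N) -> uniq s ->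
  \sum_(A : {set T} | (A \subset s) && (set_prod p A <= x)%N) inv_phi R p A
  = sqfree_sum (map p s) x.
Proof.
move=> p_gt1; elim: s x => [|i s IHs] x /=.
  move=> _; rewrite big_mkcond (bigD1 finset.set0) //= big1 ?addr0; last first.
    move=> A /finset.set0Pn[i iA]; case: (boolP (A \subset [::])) => //.
    by move=> /fintype.subsetP /(_ i iA).
  have -> : (finset.set0 : {set T}) \subset [::] by apply/fintype.subsetP => i;
    rewrite inE.
  by rewrite /set_prod /inv_phi !big_set0; case: (_ < _)%N.
move=> /andP[is_ us]; rewrite -!IHs //.
rewrite (bigID (fun A : {set T} => i \in A)) /= addrC; congr (_ + _).
  apply: eq_bigl => A; rewrite andbAC; congr (_ && _).
  apply/andP/fintype.subsetP => [[/fintype.subsetP H iA] j jA|H].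
    by have := H j jA; rewrite inE => /predU1P[e|//]; rewrite -e jA in iA.
  split; last by apply/negP => /H; apply/negP.
  by apply/fintype.subsetP => j /H; rewrite inE orbC => ->.
rewrite mulr_sumr (reindex_onto (fun B => i |: B) (fun B => B :\ i)) /=; last first.
  by move=> A /andP[_ iA]; rewrite finset.setD1K.
apply: eq_big => [B|B /andP[_ /eqP eqB]]; last first.
  by rewrite inv_phiU1 // -eqB !inE eqxx.
rewrite !inE eqxx andbT; have [iB|iB] := boolP (i \in B).
  have -> : B \subset s = false.
    by apply/negbTE/fintype.subsetPn; exists i.
  apply/negbTE/negP => /andP[_ /eqP eqB]; move: iB.
  by rewrite -eqB !inE eqxx.
rewrite finset.setU1K // eqxx andbT set_prodU1 // leq_divRL ?(ltnW (p_gt1 i))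
  // mulnC.
congr (_ && _); apply/fintype.subsetP/fintype.subsetP => H j.
  move=> jB; have := H j; rewrite !inE jB orbT => /(_ isT) /predU1P[e|//].
  by rewrite -e jB in iB.
by rewrite !inE => /predU1P[->|/H ->]; rewrite ?eqxx ?orbT.
Qed.

(** Every [n <= z] has its primes among those of [m] and the [p i]. Discarding the primes of [m]
    costs the Euler factor, and passing to the squarefree sum only increases the result. *)
Lemma selberg_G_lower (T : finType) (p : T -> nat) (m z : nat) :
  (forall i, prime (p i)) -> injective p -> (0 < m)%N ->
  (forall i, ~~ (p i %| m)%N) ->
  (forall q, prime q -> (q <= z)%N -> ~~ (q %| m)%N -> exists i, p i = q) ->
  \sum_(1 <= n < z.+1) n%:R^-1 <= euler_factor (primes m) * selberg_G R p z.
Proof.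
move=> p_pr p_inj m_gt0 p_m p_all.
have -> : selberg_G R p z = sqfree_sum (map p (enum T)) z.
  rewrite -sqfree_sum_sets ?enum_uniq // => [|i]; last exact: prime_gt1.
  apply: eq_bigl => A; suff -> : A \subset enum T by [].
  by apply/fintype.subsetP => i _; rewrite mem_enum.
have pr_m : all prime (primes m) by apply/allP => q; rewrite mem_primes => /andP[].
have pr_p : all prime (map p (enum T)) by apply/allP => q /mapP[i _ ->].
have u_p : uniq (map p (enum T)) by rewrite map_inj_uniq ?enum_uniq.
have u_mp : uniq (primes m ++ map p (enum T)).
  rewrite cat_uniq primes_uniq u_p andbT /=; apply/hasPn => q /mapP[i _ ->].
  by rewrite /= mem_primes m_gt0 (negPf (p_m i)) !andbF.
apply: (@le_trans _ _ (smooth_sum (primes m ++ map p (enum T)) z)).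
  rewrite /smooth_sum [leRHS]big_mkcond /= !big_seq; apply: ler_sum => n.
  rewrite mem_index_iota ltnS => /andP[n_gt0 le_nz].
  rewrite ifT //; apply/allP => q; rewrite mem_primes n_gt0 /= => /andP[q_pr qn].
  rewrite /= mem_cat mem_primes q_pr m_gt0 /=; have [//|qm] := boolP (q %| m)%N.
  have [|i <-] := p_all q q_pr _ qm; last by rewrite map_f ?mem_enum.
  exact: leq_trans (dvdn_leq n_gt0 qn) le_nz.
apply: le_trans (smooth_sum_cat _ u_mp pr_m) _.
by rewrite ler_wpM2l ?smooth_sum_le_sqfree ?euler_factor_ge0.
Qed.

End SmoothSums.

(** * The sum over prime powers *)

Lemma euler_factor_primes (R : realFieldType) (t : nat) :
  euler_factor R (primes t) = (Defs.rad t)%:R / (totient (Defs.rad t))%:R.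
Proof.
rewrite /Defs.rad totient_prod_primes ?primes_uniq ?all_prime_primes //.
rewrite !natr_prod -prodf_div /euler_factor big_seq [RHS]big_seq.
apply: eq_bigr => p; rewrite mem_primes => /and3P[p_pr _ _].
by rewrite -subn1 natrB ?prime_gt0.
Qed.

Lemma euler_factor_ge1 (R : realFieldType) (s : seq nat) :
  all prime s -> 1 <= euler_factor R s.
Proof.
move=> /allP pr_s; rewrite /euler_factor big_seq;
  elim/big_ind: _ => // [x y x1 y1|p ps].
  by rewrite -[1]mulr1 ler_pM.
have p1 : 1 < p%:R :> R by rewrite ltr1n prime_gt1 ?pr_s.
by rewrite ler_pdivlMr; lra.
Qed.

Lemma rad_dvd (t : nat) : (Defs.rad t %| t)%N.
Proof.
apply: dvdn_prod_primes; rewrite ?primes_uniq ?all_prime_primes // => p.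
by rewrite mem_primes => /and3P[].
Qed.

Lemma rad_gt0 (t : nat) : (0 < Defs.rad t)%N.
Proof.
rewrite /Defs.rad big_seq; elim/big_ind: _ => // [x y|p].
  by rewrite muln_gt0 => -> ->.
by rewrite mem_primes => /and3P[/prime_gt0].
Qed.

Lemma rad4_gt0 (t : nat) : (0 < rad4 t)%N.
Proof. by rewrite /rad4; case: ifP; rewrite ?muln_gt0 rad_gt0. Qed.

Lemma rad_dvd_rad4 (t : nat) : (Defs.rad t %| rad4 t)%N.
Proof. by rewrite /rad4; case: ifP => // _; apply: dvdn_mull. Qed.

Lemma prime_dvd_rad4 (p t : nat) : prime p -> (p %| rad4 t)%N -> (p %| t)%N.
Proof.
move=> p_pr; rewrite /rad4; case: ifP => [t4|_]; last first.
  by move=> /dvdn_trans; apply; apply: rad_dvd.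
rewrite Euclid_dvdM // => /orP[/dvdn_trans|/dvdn_trans]; apply; last exact: rad_dvd.
exact: dvdn_trans t4.
Qed.

(** The congruence is necessary for a nonzero count, and [q / E] is [q phi(r) / r] with
    [r = rad t]. *)
Lemma irred_binomials_bound (R : realFieldType) (F : finFieldType) (t : nat) :
  (0 < t)%N ->
  (irred_binomials F t)%:R <=
    (if (#|F| == 1 %[mod rad4 t])%N then #|F|%:R / euler_factor R (primes t) else 0).
Proof.
move=> t_gt0; have F_gt0 : (0 < #|F|)%N by rewrite ltnW // finNzRing_gt1.
have E1 := euler_factor_ge1 R (all_prime_primes t).
case: ifP => [|/negP n1].
  rewrite eqn_mod_dvd // subn1 => dv.
  have := irred_binomials_le t_gt0 (dvdn_trans (rad_dvd_rad4 t) dv).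
  rewrite -(ler_nat R) !natrM euler_factor_primes invf_div mulrA.
  by rewrite ler_pdivlMr // ltr0n rad_gt0.
case: (posnP (irred_binomials F t)) => [-> //|/(irred_binomials_dvd_card t_gt0) dv].
by case: n1; rewrite eqn_mod_dvd // subn1 dv.
Qed.

(** Such a [q] is determined by the pair of [p <= z] and [k], and [2 ^ k <= p ^ k <= N] bounds
    [k]. *)
Lemma card_smooth_prime_powers (N z : nat) (P : pred nat) :
  (forall q, P q -> exists p k, [/\ (0 < p <= z)%N, (1 < p)%N, (0 < k)%N & q =
    (p ^ k)%N]) ->
  (\sum_(0 <= q < N.+1 | P q) 1 <= z * trunc_log 2 N)%N.
Proof.
move=> HP; rewrite big_mkord sum1_card.
set L := trunc_log 2 N.
(* The coordinates hold [p - 1] and [k - 1]. *)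
pose f (x : 'I_z * 'I_L) : 'I_N.+1 := inord (x.1.+1 ^ x.2.+1).
have -> : (z * L)%N = #|[set: 'I_z * 'I_L]| by rewrite cardsT card_prod !card_ord.
apply: leq_trans _ (leq_imset_card f [set: 'I_z * 'I_L]).
apply/subset_leq_card/fintype.subsetP => q; rewrite unfold_in /= => /HP.
move=> [p [k [/andP[p_gt0 le_pz] p_gt1 k_gt0 eq]]].
have lt_p : (p.-1 < z)%N by rewrite prednK.
have leN : (p ^ k <= N)%N by rewrite -eq -ltnS.
have lt_k : (k.-1 < L)%N.
  rewrite prednK // trunc_log_max //; apply: leq_trans leN.
  by rewrite leq_exp2r.
apply/imsetP; exists (Ordinal lt_p, Ordinal lt_k) ; first by rewrite finset.in_setT.
by apply: ord_inj; rewrite /= inordK !prednK //= ltnS.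
Qed.

(** Selberg's sieve handles the prime powers free of sieving primes; each other one counts for at
    most [N]. The factor [1 / E] from the count of binomials cancels the Euler factor in the lower
    bound for [G], which leaves the harmonic sum. *)
Lemma sum_irred_binomials_le (R : realFieldType) (F : nat -> finFieldType) (t N
  z : nat) :
  finite_fields F -> (0 < t)%N -> (0 < z)%N ->
  \sum_(0 <= q < N.+1 | `[< prime_power q >]) (irred_binomials (F q) t)%:R
  <= N%:R ^+ 2 / (2 * (rad4 t)%:R * \sum_(1 <= n < z.+1) n%:R^-1)
     + 3 * N%:R * z%:R ^+ 2 + N%:R * (z * trunc_log 2 N)%:R :> R.
Proof.
move=> cardF t_gt0 z_gt0; set m := rad4 t; set H := \sum_(1 <= n < z.+1) _.
set E := euler_factor R (primes t).
have E1 : 1 <= E := euler_factor_ge1 R (all_prime_primes t).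
have E0 : 0 < E by apply: lt_le_trans E1.
have m_gt0 : (0 < m)%N := rad4_gt0 t.
(* The sieving primes are those up to [z] that do not divide [t]; they are prime to the modulus
   [m]. *)
pose T := {i : 'I_z.+1 | prime i && ~~ (i %| t)%N}.
pose p (x : T) : nat := val (val x).
have p_inj : injective p by move=> x y /val_inj /val_inj.
have p_pr x : prime (p x) by case/andP: (valP x).
have p_t x : ~~ (p x %| t)%N by case/andP: (valP x).
have p_le x : (p x <= z)%N by rewrite -ltnS ltn_ord.
have p_m x : coprime m (p x).
  by rewrite coprime_sym prime_coprime //;
    apply: contra (p_t x) => /prime_dvd_rad4; apply.
have p_all q : prime q -> (q <= z)%N -> ~~ (q %| t)%N -> exists x, p x = q.
  move=> q_pr le_qz qt; have lt_qz : (q < z.+1)%N by [].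
  have Pq : prime (Ordinal lt_qz) && ~~ (Ordinal lt_qz %| t)%N by rewrite /= q_pr.
  by exists (exist _ (Ordinal lt_qz) Pq).
pose free n := [forall x, ~~ (p x %| n)%N].
pose small n := `[< prime_power n >] && ~~ free n.
have G0 : 0 < selberg_G R p z by apply: selberg_G_gt0 => // x; apply: prime_gt1.
have H_le : H <= E * selberg_G R p z by apply: selberg_G_lower.
have H0 : 0 < H.
  by rewrite /H big_nat_recl // invr1 ltr_wpDr // sumr_ge0.
pose S1 : R := \sum_(0 <= n < N.+1 | (n == 1 %[mod m])%N && free n) n%:R.
pose S2 : R := \sum_(0 <= n < N.+1 | small n) N%:R.
have S1_le : S1 <= N%:R ^+ 2 / (2 * m%:R) / selberg_G R p z + 3 * N%:R * z%:R ^+ 2.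
  exact: selberg_sieve.
have S2_le : S2 <= N%:R * (z * trunc_log 2 N)%:R.
  have -> : S2 = N%:R * (\sum_(0 <= n < N.+1 | small n) 1)%N%:R.
    by rewrite natr_sum mulr_sumr; apply: eq_bigr => n _; rewrite mulr1.
  rewrite ler_wpM2l // ler_nat; apply: card_smooth_prime_powers => q.
  case/andP=> /asboolP[r [k [r_pr k_gt0 eq]]].
  rewrite negb_forall => /existsP[x]; rewrite negbK eq Euclid_dvdX // => /andP[].
  rewrite dvdn_prime2 // => /eqP e _; exists r, k; split=> //.
    by rewrite prime_gt0 // -e p_le.
  exact: prime_gt1.
apply: (@le_trans _ _ (E^-1 * (S1 + S2))).
  rewrite mulrDr /S1 /S2 !mulr_sumr [X in _ <= X + _]big_mkcond.
  rewrite [X in _ <= _ + X]big_mkcond -big_split big_mkcond /= !big_seq;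
    apply: ler_sum => q.
  rewrite mem_index_iota ltnS => /andP[_ le_qN].
  have term_ge0 n : 0 <= E^-1 * n%:R by rewrite mulr_ge0 // invr_ge0 ltW.
  rewrite /small; case: ifP => [/asboolP pp|_] /=; last first.
    by rewrite addr0; case: ifP.
  have := irred_binomials_bound R (F q) t_gt0; rewrite cardF // => /le_trans; apply.
  rewrite -/m -/E; case: (q == 1 %[mod m])%N => /=; last by rewrite add0r; case: ifP.
  case: (free q) => /=; first by rewrite addr0 mulrC.
  by rewrite add0r mulrC ler_wpM2l ?invr_ge0 ?(ltW E0) // ler_nat.
(* Only the main term keeps [1 / E]; for the errors [1 / E <= 1] is enough. *)
apply: (@le_trans _ _ (E^-1 * (N%:R ^+ 2 / (2 * m%:R) / selberg_G R p z)
   + (3 * N%:R * z%:R ^+ 2 + N%:R * (z * trunc_log 2 N)%:R))).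
  apply: (@le_trans _ _ (E^-1 * (N%:R ^+ 2 / (2 * m%:R) / selberg_G R p z) + E^-1 *
     (3 * N%:R * z%:R ^+ 2 + N%:R * (z * trunc_log 2 N)%:R))).
    by rewrite -mulrDr addrA ler_wpM2l ?invr_ge0 ?(ltW E0) // lerD.
  by rewrite lerD2l ler_piMl ?invf_le1 //.
rewrite -addrA lerD2r.
have m0 : 0 < m%:R :> R by rewrite ltr0n.
have -> : E^-1 * (N%:R ^+ 2 / (2 * m%:R) / selberg_G R p z)
   = N%:R ^+ 2 / (2 * m%:R) * (E * selberg_G R p z)^-1.
  by field; rewrite !gt_eqF.
have -> : N%:R ^+ 2 / (2 * m%:R * H) = N%:R ^+ 2 / (2 * m%:R) * H^-1.
  by field; rewrite !gt_eqF.
rewrite ler_wpM2l //.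
by rewrite lef_pV2 ?posrE // mulr_gt0.
Qed.

(** * Asymptotics *)

Section RealEstimates.
Variable R : realType.
Implicit Types (x a b : R).

Lemma gt0_powRD x a b : 0 < x -> x `^ (a + b) = x `^ a * x `^ b.
Proof. by move=> x0; rewrite powRD // (gt_eqF x0) implybT. Qed.

Lemma ln_le_sub1 x : 0 < x -> ln x <= x - 1.
Proof.
move=> x0; have := @le_ln1Dx R (x - 1).
have -> : 1 + (x - 1) = x by ring.
by apply; lra.
Qed.

(** Apply [ln y <= y - 1] to [y = x ^ a]. *)
Lemma ln_le_powR x a : 0 < x -> 0 < a -> ln x <= a^-1 * x `^ a.
Proof.
move=> x0 a0; rewrite mulrC ler_pdivlMr // mulrC -ln_powR.
have := ln_le_sub1 (powR_gt0 a x0); lra.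
Qed.

Lemma ln_le_harmonic (z : nat) : ln z.+1%:R <= \sum_(1 <= n < z.+1) n%:R^-1 :> R.
Proof.
elim: z => [|z IHz]; first by rewrite ln1 big_geq.
rewrite big_nat_recr //=.
have z0 : 0 < z.+1%:R :> R by rewrite ltr0n.
have -> : z.+2%:R = z.+1%:R * (1 + z.+1%:R^-1) :> R.
  by rewrite mulrDr mulr1 divff ?gt_eqF // natr1.
have i0 : 0 < z.+1%:R^-1 :> R by rewrite invr_gt0.
rewrite lnM ?posrE // ?addr_gt0 // lerD //.
by apply: le_ln1Dx; apply: lt_trans i0; apply: ltrN10.
Qed.

Lemma ln2_ge : 2^-1 <= ln 2 :> R.
Proof.
have := @ln_le_sub1 2^-1; rewrite lnV ?posrE //; have h : 0 < 2^-1 :> R by lra.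
move=> /(_ h); lra.
Qed.

Lemma trunc_log2_le (Q : R) : 1 <= Q -> (trunc_log 2 (Num.truncn Q))%:R <= 2 * ln Q.
Proof.
move=> Q1; set L := trunc_log _ _.
have N0 : (0 < Num.truncn Q)%N by rewrite truncn_gt0.
have := trunc_logP (isT : (1 < 2)%N) N0; rewrite -/L -(ler_nat R) natrX => le1.
have {}le1 : 2 ^+ L <= Q.
  by apply: le_trans le1 _; rewrite truncn_le (le_trans ler01).
have : ln (2 ^+ L) <= ln Q by rewrite ler_ln // posrE ?exprn_gt0 //; lra.
rewrite lnXn // -[X in X <= _]mulr_natl => le2.
have := ler_wpM2l (ler0n R L) ln2_ge; lra.
Qed.

Lemma powR_unbounded (a C : R) : 0 < a -> exists X0, forall X, X0 <= X -> C <= X `^ a.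
Proof.
move=> a0; exists ((Num.max C 1) `^ a^-1) => X leX.
have M0 : 0 <= Num.max C 1 :> R by rewrite le_max ler01 orbT.
apply: (@le_trans _ _ (Num.max C 1)); first by rewrite le_max lexx.
move: M0 leX; set M := Num.max C 1 => M0 leX.
rewrite -[leLHS](powRr1 M0) -[X in M `^ X <= _](mulVf (lt0r_neq0 a0)) powRrM.
apply: ge0_ler_powR; rewrite ?nnegrE ?powR_ge0 //; first exact: ltW.
exact: le_trans (powR_ge0 _ _) leX.
Qed.

(** The growth conditions of the final estimate: the third absorbs the remainder [3 N z ^ 2] of the
    sieve, the fourth the powers of small primes. *)
Lemma eventually_large (eps delta eta : R) : 0 < eps -> 0 < delta -> 0 < eta ->
  exists X0, forall X, X0 <= X ->
    [/\ 1 <= X, 2 <= ln X, 9 * ln X <= delta * X `^ eta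
      & 6 * ln X ^+ 2 <= eps * delta * X `^ 2^-1].
Proof.
move=> eps0 delta0 eta0; have h0 : 0 < eta / 2 by lra.
have q0 : 0 < 4^-1 :> R by lra.
have e0 : 0 < 8^-1 :> R by lra.
(* The constants come from [ln X <= (2 / eta) X ^ (eta / 2)], with [18 = 9 * 2], and from
   [ln X <= 8 X ^ (1 / 8)], with [384 = 6 * 8 ^ 2]. *)
have [X1 H1] := powR_unbounded (18 / (eta * delta)) h0.
have [X2 H2] := powR_unbounded (384 / (eps * delta)) q0.
exists (Num.max (Num.max X1 X2) (expR 2)) => X;
  rewrite !ge_max => /andP[/andP[/H1 {}H1 /H2 {}H2] H3].
have X1' : 1 <= X by apply: le_trans H3; rewrite -expR0 ler_expR.
have X_gt0 : 0 < X by lra.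
split=> //.
- by rewrite -(expRK 2) ler_ln // posrE ?expR_gt0.
- have le1 := ln_le_powR X_gt0 h0.
  have -> : X `^ eta = X `^ (eta / 2) * X `^ (eta / 2).
    by rewrite -gt0_powRD //; congr (_ `^ _); field.
  move: le1 H1; have := powR_ge0 X (eta / 2); set Y := X `^ _ => Y0 le1.
  rewrite ler_pdivrMr ?mulr_gt0 // => le2.
  have {}le1 : eta * ln X <= 2 * Y.
    by move: le1; rewrite invf_div mulrAC ler_pdivlMr // mulrC.
  rewrite -(ler_pM2l eta0); nra.
- have le1 := ln_le_powR X_gt0 e0; rewrite invrK in le1.
  have eY : X `^ 4^-1 = X `^ 8^-1 ^+ 2.
    by rewrite expr2 -gt0_powRD //; congr (_ `^ _); field.
  have -> : X `^ 2^-1 = X `^ 4^-1 * X `^ 4^-1.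
    by rewrite -gt0_powRD //; congr (_ `^ _); field.
  have l0 : 0 <= ln X by apply: ln_ge0.
  have le2 : ln X ^+ 2 <= 64 * X `^ 4^-1.
    have -> : 64 * X `^ 4^-1 = (8 * X `^ 8^-1) ^+ 2 by rewrite eY; ring.
    by rewrite ler_sqr ?nnegrE // mulr_ge0 ?powR_ge0.
  move: le2 H2; have := powR_ge0 X 4^-1; set Y := X `^ 4^-1 => Y0 le2.
  rewrite ler_pdivrMr ?mulr_gt0 // => le3.
  have := ler_wpM2r Y0 le3; nra.
Qed.

End RealEstimates.

Theorem theorem1p1 (R : realType) (eps : R) (eps_gt0 : 0 < eps) :
  forall delta : R, 0 < delta ->
  exists Q0 : R, forall (F : nat -> finFieldType) (Q : R) (t : nat),
    finite_fields F ->
    Q0 <= Q ->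
    (0 < t)%N ->
    (rad4 t)%:R <= Q `^ (1 - eps) ->
    \sum_(0 <= q < (Num.truncn Q).+1 | `[< prime_power q >])
        (irred_binomials (F q) t)%:R
      <= (1 + delta) * (Q ^+ 2 / ((rad4 t)%:R * log (Q / (rad4 t)%:R))).
Proof.
(* [1 / (1 - eta) = 1 + delta / 3]. *)
move=> delta delta0; pose eta := delta / (3 + delta).
have d3 : 0 < 3 + delta by lra.
have eta0 : 0 < eta by rewrite divr_gt0.
have eta1 : eta < 1 by rewrite ltr_pdivrMr //; lra.
have [X0 HX] := eventually_large eps_gt0 delta0 eta0.
have [Q1 HQ] := powR_unbounded X0 eps_gt0.
(* The hypothesis on [rad4 t] gives [Q / m >= Q ^ eps], so [Q >= Q1] makes [Q / m] exceed [X0]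
   uniformly in [t]. *)
exists (Num.max Q1 1) => F Q t cardF; rewrite ge_max => /andP[/HQ {}HQ Q_ge1] t_gt0.
set m := rad4 t => m_le.
have m_gt0 : 0 < m%:R :> R by rewrite ltr0n rad4_gt0.
have Q_gt0 : 0 < Q by lra.
set X := Q / m%:R.
have X_ge : Q `^ eps <= X.
  rewrite /X ler_pdivlMr // mulrC; apply: le_trans (ler_wpM2r (powR_ge0 _ _) m_le) _.
  by rewrite -gt0_powRD // subrK powRr1 // ltW.
have XE : X = Q / m%:R by []; clearbody X.
have [X1 lnX2 HX1 HX2] := HX X (le_trans HQ X_ge).
have X_gt0 : 0 < X by lra.
(* As [ln X >= 2], the truncation in [log] has no effect. *)
have -> : log X = ln X by rewrite /log; apply/max_idPl.
set l := ln X in lnX2 HX1 HX2 *.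
(* With this level [ln Z] is [(1 - eta) / 2] times [ln X], while [Z ^ 2] stays a power of [X] below
   [X] in the remainder. *)
pose Z := X `^ ((1 - eta) / 2); pose z := Num.truncn Z.
have Z1 : 1 <= Z.
  by rewrite -[leLHS](powRr0 X) ler_powR //; lra.
have z_gt0 : (0 < z)%N by rewrite truncn_gt0.
have zZ : z%:R <= Z by rewrite truncn_le (le_trans ler01).
have Zsq : Z ^+ 2 = X `^ (1 - eta).
  by rewrite expr2 -gt0_powRD //; congr (_ `^ _); field.
have Zle : Z <= X `^ 2^-1 by rewrite ler_powR //; lra.
set N := Num.truncn Q.
have NQ : N%:R <= Q by rewrite truncn_le ltW.
set H := \sum_(1 <= n < z.+1) n%:R^-1 : R.
(* Since [Z < z + 1], the bound [ln (z + 1) <= H] loses nothing by rounding. *)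
have H_ge : (1 - eta) / 2 * l <= H.
  rewrite -ln_powR -/Z; apply: le_trans (ln_le_harmonic R z).
  by rewrite ler_ln ?posrE //; [apply/ltW/truncnS_gt|lra].
(* [Q ^ eps <= X] gives [ln Q <= l / eps]. *)
have L_le : (trunc_log 2 N)%:R <= 2 * l / eps.
  apply: le_trans (trunc_log2_le Q_ge1) _.
  rewrite -mulrA ler_wpM2l // ler_pdivlMr // mulrC -ln_powR.
  by rewrite ler_ln ?posrE // powR_gt0.
apply: le_trans (sum_irred_binomials_le R N cardF t_gt0 z_gt0) _; rewrite -/m -/H.
have l0 : 0 < l by lra.
have N0 := ler0n R N; have z0 := ler0n R z; have L0 := ler0n R (trunc_log 2 N).
have H0 : 0 < H by apply: lt_le_trans H_ge; rewrite mulr_gt0 //; lra.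
(* As [Q ^ 2 / m = Q X], the target is [(1 + delta) Q X / l]: the main term takes [1 + delta / 3],
   and each of the two errors [delta / 3]. *)
have T1 : N%:R ^+ 2 / (2 * m%:R * H) <= (1 + delta / 3) * (Q * X / l).
  apply: (@le_trans _ _ (Q ^+ 2 / (2 * m%:R * ((1 - eta) / 2 * l)))).
    have m2 : 0 < 2 * m%:R :> R by rewrite mulr_gt0.
    have b0 : 0 < (1 - eta) / 2 * l by rewrite mulr_gt0 //; lra.
    rewrite ler_pM ?sqr_ge0 ?invr_ge0 //.
    - by rewrite !mulr_ge0 // ltW.
    - by rewrite ler_sqr ?nnegrE // ltW.
    - by rewrite lef_pV2 ?posrE ?(mulr_gt0 m2) // ler_pM2l.
  rewrite le_eqVlt; apply/orP; left; apply/eqP; rewrite XE /eta.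
  by field; rewrite !gt_eqF //=; lra.
(* The remainder is at most [3 Q X ^ (1 - eta)], and [9 l <= delta X ^ eta]. *)
have T2 : 3 * N%:R * z%:R ^+ 2 <= delta / 3 * (Q * X / l).
  apply: (@le_trans _ _ (3 * Q * X `^ (1 - eta))).
    by rewrite -Zsq ler_pM ?mulr_ge0 ?sqr_ge0 // ?ler_sqr ?nnegrE ?ler_wpM2l //; lra.
  have eX : X = X `^ (1 - eta) * X `^ eta.
    by rewrite -gt0_powRD // subrK powRr1 // ltW.
  rewrite !mulrA ler_pdivlMr // [leRHS](_ : _ = delta / 3 * Q * (X `^ (1 - eta)
    * X `^ eta)); last by rewrite -eX.
  have Y0 := powR_gt0 (1 - eta) X_gt0.
  have := ler_wpM2l (ltW (mulr_gt0 Q_gt0 Y0)) HX1.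
  set Y := X `^ (1 - eta); set W := X `^ eta; lra.
(* Here [z <= X ^ (1 / 2)] and the logarithm is at most [2 l / eps], so
   [6 l ^ 2 <= eps delta X ^ (1 / 2)] suffices. *)
have T3 : N%:R * (z * trunc_log 2 N)%:R <= delta / 3 * (Q * X / l).
  rewrite natrM.
  apply: (@le_trans _ _ (Q * (X `^ 2^-1 * (2 * l / eps)))).
    rewrite ler_pM ?mulr_ge0 // ler_pM //; exact: le_trans Zle.
  have eX : X = X `^ 2^-1 * X `^ 2^-1.
    by rewrite -gt0_powRD // -[LHS]powRr1 ?ltW //; congr (_ `^ _); field.
  rewrite !mulrA ler_pdivlMr // [leRHS](_ : _ = delta / 3 * Q * (X `^ 2^-1 * X
    `^ 2^-1)); last by rewrite -eX.
  have Y0 := powR_ge0 X 2^-1.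
  have := ler_wpM2l (mulr_ge0 (ltW Q_gt0) Y0) HX2.
  set Y := X `^ 2^-1; rewrite -(ler_pM2l eps_gt0 (_ * l)) => le1.
  have -> : eps * (Q * Y * 2 * l / eps * l) = Q * Y * 2 * l * l.
    by field; rewrite gt_eqF.
  move: le1; lra.
have -> : (1 + delta) * (Q ^+ 2 / (m%:R * l)) =
  (1 + delta / 3) * (Q * X / l) + delta / 3 * (Q * X / l) + delta / 3 * (Q * X / l).
  by rewrite XE; field; rewrite !gt_eqF.
by rewrite !lerD.
Qed.
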